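(* Let $F$ be a finite forest with no vertices of degree $2$ and no isolated vertices, and let $n_1$ be the number of vertices of degree $1$ in $F$. Then the total vertex irregularity strength of $F$ satisfies \[ tvs(F)=\left\lceil \tfrac{n_1+1}{2} \right\rceil. \]
   Context: Graphs are finite, simple and undirected. For a graph $G$, a total weighting is a map $w: V(G)\cup E(G)\to \{1,2,\dots\}$; the weighted degree of a vertex $v$ is $wt_G(v)=w(v)+\sum_{e\in E(G),\, v\in e} w(e)$. The weighting is irregular if $wt_G(u)\neq wt_G(v)$ for all distinct $u,v\in V(G)$. The total vertex irregularity strength $tvs(G)$ is the smallest integer $s$ such that there is an irregular total weighting of $G$ with values in $\{1,2,\dots,s\}$. *)

(* Defs.v *)
From mathcomp Require Import all_boot.
Set Implicit Arguments. Unset Strict Implicit. Unset Printing Implicit Defensive.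

Definition simple_graph (V : finType) (e : rel V) : Prop :=
  symmetric e /\ irreflexive e.

Definition deg (V : finType) (e : rel V) (v : V) : nat := #|[set u | e v u]|.

Definition has_cycle (V : finType) (e : rel V) : Prop :=
  exists (x : V) (q : seq V),
    [/\ 2 <= size q, uniq (x :: q), path e x q & e (last x q) x].

Definition forest (V : finType) (e : rel V) : Prop :=
  simple_graph e /\ ~ has_cycle e.

(* Weighted degree under a total weighting: vertex weights wv, edge weights we
   (indexed by the edge as a 2-set; only values on edges matter). *)
Definition wt (V : finType) (e : rel V) (wv : V -> nat) (we : {set V} -> nat)
  (v : V) : nat :=
  wv v + \sum_(u in V | e v u) we [set v; u].

Definition irregular_weighting_exists (V : finType) (e : rel V) (s : nat) : Prop :=
  exists (wv : V -> nat) (we : {set V} -> nat),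
    [/\ forall v, 1 <= wv v <= s,
        forall x y, e x y -> 1 <= we [set x; y] <= s
      & forall u v, u != v -> wt e wv we u != wt e wv we v].

Definition tvs_is (V : finType) (e : rel V) (k : nat) : Prop :=
  irregular_weighting_exists e k /\
  forall s, irregular_weighting_exists e s -> k <= s.

(* Main.v *)
(** The lower bound counts the leaves, whose weighted degrees are distinct
    elements of [2, 2s].

    For the upper bound put s = ceil((n1+1)/2) and list the leaves so that the
    i-th one, i = 0, ..., n1-1, gets weighted degree i+2 and pendant edge
    min(s, i+1); all other edges get s.  So only the first s-1 leaves ("small")
    have a pendant edge below s.  An internal vertex v of degree d with exactly
    one small leaf has edge sum strictly between (d-1)s and ds, and these sums
    are pairwise distinct.  If every internal edge sum is at least 2s and at
    most s-1 internal vertices do not have exactly one small leaf, vertex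
    weights in [1, s] can be chosen to make all internal weighted degrees
    distinct and larger than 2s.  The order of the leaves therefore spreads the
    small ones: first the components K2, then one leaf per internal vertex
    adjacent to a leaf, and last a second leaf of each such vertex; a star
    component moreover gets a third leaf whose edge compensates its first.
    Acyclicity enters through two degree counts. *)
Require Import Defs.
From mathcomp Require Import all_boot zify.
Set Implicit Arguments. Unset Strict Implicit. Unset Printing Implicit Defensive.

(** * Separating values by small offsets *)

(* An element z of B enters at value p z + 1, every larger value being bumped by 1. *)
Lemma injective_offsets (V : finType) (p : V -> nat) (A B : {set V}) :
  [disjoint A & B] -> {in A &, injective p} ->
  exists w : V -> nat, (forall v, 1 <= w v <= #|B|.+1) /\
    {in A :|: B &, injective (fun v => p v + w v)}.
Proof.
move: {2}#|B| (leqnn #|B|) => n; elim: n B => [|n IHn] B.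
  rewrite leqn0 cards_eq0 => /eqP-> _ injp; exists (fun=> 1); split=> [v|].
    by rewrite cards0.
  by move=> u v; rewrite setU0 => Au Av /addIn; apply: injp.
case: (set_0Vmem B) => [-> _ disj injp|[z Bz] leBn disj injp].
  by apply: IHn; rewrite ?cards0.
have cardB : #|B| = #|B :\ z|.+1 by rewrite (cardsD1 z B) Bz.
have zA : z \notin A.
  by apply/negP => Az; move: disj => /pred0P/(_ z) /=; rewrite Az Bz.
have [||//|w [wP winj]] := IHn (B :\ z); first by lia.
  by apply: disjointWr disj; apply: subsetDl.
pose w' v := if v == z then 1 else w v + (p z < p v + w v).
exists w'; split=> [v|u v].
  rewrite /w'; case: eqP => [//|_]; have := wP v; rewrite cardB; lia.
have inAB x : x \in A :|: B -> x != z -> x \in A :|: B :\ z.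
  by rewrite !inE => /orP[->//|->] ->; rewrite orbT.
move=> /inAB Hu /inAB Hv; rewrite /w'.
have [->|uz] := eqVneq u z; have [->|vz] := eqVneq v z => //.
- by have := wP v; lia.
- by have := wP u; lia.
by move=> E; apply: winj; rewrite ?Hu ?Hv //; lia.
Qed.

(** * Degrees in induced subgraphs of a forest *)

(** The path up to [y] is closed by the edge back to [x]; as [y] is not the first vertex of [q],
    this is at least a triangle. *)
Lemma cycle_of_mem_path (V : finType) (e : rel V) (x y : V) (q : seq V) :
  symmetric e -> uniq (x :: q) -> path e x q -> e x y -> y \in q ->
  y != head y q -> has_cycle e.
Proof.
move=> sym Uq Pq exy yq neq; exists x, (take (index y q).+1 q).
have iq : index y q < size q by rewrite index_mem.
split.
- rewrite size_takel //; case: q neq {Uq Pq yq iq} => [|a q] /=; first by rewrite eqxx.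
  by rewrite eq_sym => /negPf->.
- by apply: subseq_uniq Uq; rewrite /= eqxx take_subseq.
- by apply: (take_path _ Pq).
by rewrite (take_nth y) // last_rcons nth_index // sym.
Qed.

(** Otherwise a path inside [X] could be extended at its front for ever: one of two neighbours is
    not the next vertex of the path, and it either closes a cycle or lengthens the path. *)
Lemma forest_low_degree (V : finType) (e : rel V) (X : {set V}) :
  forest e -> X != set0 -> exists2 x, x \in X & #|[set u in X | e x u]| <= 1.
Proof.
move=> [[sym irr] acyc] /set0Pn[x0 Xx0].
apply/exists_inP; apply: contraT => /exists_inPn deg2; exfalso.
suff long n : exists x q,
    [/\ size q = n, uniq (x :: q), path e x q & all (mem X) (x :: q)].
  have [x [q [sq Uq _ _]]] := long #|V|.
  by have := max_card (mem (x :: q)); rewrite (card_uniqP Uq) /= sq ltnn.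
elim: n => [|n [x [q [sq Uq Pq Xq]]]]; first by exists x0, [::]; rewrite /= Xx0.
have /andP[Xx _] := Xq.
have /card_gt1P[a [b [Ha Hb ab]]] : 1 < #|[set u in X | e x u]|.
  by rewrite ltnNge deg2.
(* For empty [q] the implication is vacuous, so the default of [head] is harmless. *)
have [y Xy /andP[exy neq]] : exists2 y, y \in X & e x y && ((y \in q) ==> (y != head y q)).
  move: Ha Hb; rewrite !inE => /andP[Xa ea] /andP[Xb eb].
  have [aq|aq] := boolP ((a \in q) ==> (a != head a q)).
    by exists a => //; rewrite ea.
  exists b; rewrite // eb; apply/implyP => bq.
  move: aq; rewrite negb_imply negbK => /andP[aq /eqP Ea].
  case: q {sq Uq Pq Xq bq} aq Ea => //= c q _ <-.
  by rewrite eq_sym.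
have [yq|yq] := boolP (y \in q).
  by case: acyc; apply: (cycle_of_mem_path sym Uq Pq exy yq); apply: (implyP neq).
exists y, (x :: q); split; first by rewrite /= sq.
- rewrite cons_uniq Uq inE negb_or yq !andbT.
  by apply/eqP => E; move: exy; rewrite E irr.
- by rewrite /= sym exy.
by apply/andP.
Qed.

(** This is the edge bound |X| - 1 for a forest: deleting a vertex of degree at most 1 lowers the
    degree sum by at most 2. *)
Lemma forest_degree_sum (V : finType) (e : rel V) (X : {set V}) :
  forest e -> X != set0 -> \sum_(v in X) #|[set u in X | e v u]| + 2 <= 2 * #|X|.
Proof.
move=> Fe; move: {2}#|X| (leqnn #|X|) => n; elim: n X => [|n IHn] X.
  by rewrite leqn0 cards_eq0 => /eqP->; rewrite eqxx.
move=> leX /(forest_low_degree Fe)[x Xx dx].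
have cardX : #|X| = #|X :\ x|.+1 by rewrite (cardsD1 x X) Xx.
have [[sym irr] _] := Fe.
have degE v : v \in X :\ x -> #|[set u in X | e v u]| = e x v + #|[set u in X :\ x | e v u]|.
  move=> _; rewrite (cardsD1 x) !inE Xx sym; congr (_ + _).
  by apply: eq_card => u; rewrite !inE andbA.
have dxE : \sum_(v in X :\ x) e x v = #|[set u in X | e x u]|.
  rewrite -sum1_card big_mkcond [RHS]big_mkcond; apply: eq_bigr => v _.
  rewrite !inE; have [->|_] := eqVneq v x; first by rewrite irr andbF.
  by case: (v \in X); case: (e x v).
rewrite (big_setD1 x Xx) /= (eq_bigr _ degE) big_split /= dxE.
have [X'0|X'0] := eqVneq (X :\ x) set0.
  by move: dxE; rewrite X'0 !big_set0 => <-; lia.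
have := IHn (X :\ x); rewrite X'0 => /(_ _ isT); lia.
Qed.

(** * Leaves and the lower bound *)

Lemma wt_leaf (V : finType) (e : rel V) wv we (v u : V) :
  (forall x, e v x = (x == u)) -> wt e wv we v = wv v + we [set v; u].
Proof.
move=> par; rewrite /wt; congr (_ + _).
by rewrite (eq_bigl (pred1 u)) ?big_pred1_eq // => x; rewrite /= par.
Qed.

Lemma leaf_nbr (V : finType) (e : rel V) (v : V) :
  deg e v == 1 -> exists u, forall x, e v x = (x == u).
Proof.
by move=> /cards1P[u E]; exists u => x; move/setP/(_ x): E; rewrite !inE.
Qed.

Definition neighbor (V : finType) (e : rel V) (x : V) : V :=
  odflt x [pick y | e x y].

Lemma neighborP (V : finType) (e : rel V) (x : V) :
  deg e x == 1 -> forall y, e x y = (y == neighbor e x).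
Proof.
move=> /leaf_nbr[u uP] y; rewrite uP /neighbor; case: pickP => [z|/(_ u)].
  by rewrite uP => /eqP->.
by rewrite uP eqxx.
Qed.

Lemma tvs_lower_bound (V : finType) (e : rel V) (s : nat) :
  0 < #|V| -> irregular_weighting_exists e s ->
  #|[set v : V | deg e v == 1]|.+2 %/ 2 <= s.
Proof.
move=> /card_gt0P[v0 _] [wv [we [wvP weP irr]]].
have s_gt0 : 0 < s by have := wvP v0; lia.
suff : #|[set v : V | deg e v == 1]| <= (2 * s).-1 by lia.
have leafP v : deg e v == 1 -> 2 <= wt e wv we v <= 2 * s.
  move=> /leaf_nbr[u uP]; rewrite (wt_leaf _ _ uP).
  by have := wvP v; have := weP v u; rewrite uP eqxx => /(_ isT); lia.
have -> : (2 * s).-1 = #|'I_(2 * s).-1| by rewrite card_ord.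
have lt0 : 0 < (2 * s).-1 by lia.
(* Leaf weights shifted by 2 are below 2s - 1, so the default [Ordinal lt0] is never taken. *)
rewrite -(card_in_imset (f := fun v => insubd (Ordinal lt0) (wt e wv we v - 2))).
  exact: max_card.
move=> u v; rewrite !inE => /leafP du /leafP dv /(congr1 val).
rewrite !val_insubd !ifT; [|lia|lia] => E; apply/eqP/negPn/negP => /irr /eqP; lia.
Qed.

(** * From a numbering of the leaves to a weighting *)

(** A leaf [x] is to get weighted degree [idx x + 2]. The condition on adjacent leaves keeps their
    vertex weights at most s, the bound 2s on edge sums puts internal vertices above all leaves, and
    the last bound leaves room for offsets in [1, s]. *)
Lemma weighting_of_index (V : finType) (e : rel V) (s : nat) (idx : V -> nat) :
  simple_graph e ->
  {in [pred x | deg e x == 1] &, injective idx} ->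
  (forall x, deg e x == 1 -> idx x + 2 <= 2 * s) ->
  (forall x, deg e x != 1 -> s.-1 <= idx x) ->
  (forall x y, deg e x == 1 -> deg e y == 1 -> e x y -> idx x <= idx y + s.-1) ->
  (forall v, deg e v != 1 -> 2 * s <= \sum_(u | e v u) (s - (s.-1 - idx u))) ->
  #|[set v | (deg e v != 1) && (#|[set u | e v u & idx u < s.-1]| != 1)]| < s ->
  irregular_weighting_exists e s.
Proof.
move=> [sym irr] idx_inj idx_lt idx_ge idxK p_ge ltB.
set B := [set v | _] in ltB.
pose delta x := s.-1 - idx x.
(* The end with the smaller index decides the label; internal vertices have deficit 0. *)
pose we (A : {set V}) := s - \max_(x in A) delta x.
have weE x y : e x y -> we [set x; y] = s - maxn (delta x) (delta y).
  move=> exy; rewrite /we big_setU1 ?big_set1 // inE.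
  by apply/eqP => E; move: exy; rewrite E irr.
have s_gt0 : 0 < s by lia.
have weP x y : e x y -> 1 <= we [set x; y] <= s.
  by move=> exy; rewrite weE // /delta; lia.
pose p v := \sum_(u | e v u) (s - delta u).
pose A := [set v | (deg e v != 1) && (#|[set u | e v u & idx u < s.-1]| == 1)].
have pA v : v \in A -> exists u, [/\ e v u, deg e u == 1, idx u < s.-1
                                  & p v + delta u = deg e v * s].
  rewrite inE => /andP[_ /cards1P[u Eu]]; exists u.
  have uP x : (e v x && (idx x < s.-1)) = (x == u).
    by move/setP/(_ x): Eu; rewrite !inE.
  have /andP[evu ltu] : e v u && (idx u < s.-1) by rewrite uP.
  split=> //; first by apply: contraLR ltu => /idx_ge; rewrite -leqNgt.
  have -> : delta u = \sum_(x | e v x) delta x.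
    rewrite (bigD1 u) //= big1 ?addn0 // => x /andP[evx xu].
    by apply/eqP; rewrite subn_eq0 leqNgt; have := uP x; rewrite evx (negPf xu) => /= ->.
  rewrite -big_split /= (eq_bigr (fun=> s)) => [|x _]; last by rewrite /delta; lia.
  by rewrite sum_nat_const; congr (_ * _); rewrite /deg; apply: eq_card => x; rewrite !inE.
(* The deficit of the single small leaf lies strictly between 0 and s, so [p v] determines the
   degree and the deficit, hence the leaf and its neighbour [v]. *)
have p_inj : {in A &, injective p}.
  move=> v v' /pA[u [evu du ltu Eu]] /pA[u' [evu' du' ltu' Eu']] Ep.
  have Edeg : deg e v = deg e v'.
    have lt1 : deg e v * s < (deg e v').+1 * s by rewrite mulSn -Eu -Eu' /delta; lia.
    have lt2 : deg e v' * s < (deg e v).+1 * s by rewrite mulSn -Eu -Eu' /delta; lia.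
    by move: lt1 lt2; rewrite !ltn_pmul2r //; lia.
  have uu' : u = u'.
    by apply: idx_inj => //; move: Eu Eu'; rewrite Ep Edeg /delta; lia.
  have [w wP] := leaf_nbr du; move: evu evu'; rewrite -uu' ![e _ u]sym !wP.
  by move=> /eqP-> /eqP->.
have disj : [disjoint A & B].
  by apply/pred0P => v; rewrite !inE /=; case: (_ == 1); case: (_ == 1).
have [w [wP w_inj]] := injective_offsets disj p_inj.
(* A leaf tops its edge label up to [idx x + 2]; an internal vertex takes its offset. *)
pose wv x := if deg e x == 1 then idx x + 2 - we [set x; neighbor e x] else w x.
have wt_leafE x : deg e x == 1 -> wt e wv we x = idx x + 2 /\ 1 <= wv x <= s.
  move=> dx; have exn : e x (neighbor e x) by rewrite (neighborP dx).
  have key : we [set x; neighbor e x] < idx x + 2 <= we [set x; neighbor e x] + s.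
    rewrite weE //; have := idx_lt x dx; rewrite /delta.
    have [dn|/idx_ge] := boolP (deg e (neighbor e x) == 1); last by lia.
    by have := idxK _ _ dx dn exn; lia.
  by rewrite (wt_leaf _ _ (neighborP dx)) /wv dx; lia.
have wt_internal v : deg e v != 1 -> wt e wv we v = p v + w v.
  move=> dv; rewrite /wt /wv (negPf dv) addnC; congr (_ + _).
  apply: eq_bigr => u evu; rewrite weE //.
  by have := idx_ge v dv; rewrite /delta; lia.
exists wv, we; split=> // [v|u v].
  have [/wt_leafE[]//|dv] := boolP (deg e v == 1).
  by rewrite /wv (negPf dv); have := wP v; lia.
have big x : deg e x != 1 -> 2 * s < wt e wv we x.
  by move=> dx; rewrite wt_internal //; have := wP x; have : 2 * s <= p x := p_ge x dx; lia.
have small x : deg e x == 1 -> wt e wv we x <= 2 * s.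
  by move=> dx; have [-> _] := wt_leafE x dx; apply: idx_lt.
have inAB x : deg e x != 1 -> x \in A :|: B.
  by move=> dx; rewrite !inE dx /=; case: (_ == 1).
apply: contraNneq => E; apply/eqP.
have [du|du] := boolP (deg e u == 1); have [dv|dv] := boolP (deg e v == 1).
- have [Eu _] := wt_leafE u du; have [Ev _] := wt_leafE v dv.
  by apply: idx_inj => //; lia.
- by have := small u du; have := big v dv; lia.
- by have := small v dv; have := big u du; lia.
by apply: w_inj; rewrite ?inAB // -!wt_internal.
Qed.

Lemma index_block (T : eqType) (x0 : T) (s1 s2 s3 : seq T) (i : nat) :
  uniq (s1 ++ s2 ++ s3) -> i < size s2 ->
  index (nth x0 s2 i) (s1 ++ s2 ++ s3) = size s1 + i.
Proof.
move=> U lti; rewrite -[RHS](index_uniq x0 _ U) ?size_cat; last by lia.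
congr index; rewrite nth_cat ifF; last by lia.
by rewrite addKn nth_cat lti.
Qed.

Lemma leq_sum_uniq (T : finType) (P : pred T) (f : T -> nat) (l : seq T) :
  uniq l -> all P l -> \sum_(x <- l) f x <= \sum_(x | P x) f x.
Proof.
move=> Ul /allP Pl; rewrite big_uniq // [leqRHS](bigID (mem l)) /=.
apply: leq_trans (leq_addr _ _); rewrite leq_eqVlt; apply/orP; left; apply/eqP.
by apply: eq_bigl => x; case: (boolP (x \in l)) => [/Pl->|]; rewrite ?andbF.
Qed.

Lemma label_max s i : s.-1 <= i -> s - (s.-1 - i) = s.
Proof. lia. Qed.

(** * The order of the leaves *)

Section LeafOrder.

Variables (V : finType) (e : rel V).
Hypothesis Fe : forest e.
Hypothesis deg_neq2 : forall v, deg e v != 2.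
Hypothesis deg_neq0 : forall v, deg e v != 0.

Let sym : symmetric e := proj1 (proj1 Fe).
Let irr : irreflexive e := proj2 (proj1 Fe).

Let leaf v := deg e v == 1.
Let nbr := neighbor e.

Let nbrP x : leaf x -> forall y, e x y = (y == nbr x).
Proof. exact: neighborP. Qed.

Let leaf_nbrE x y : leaf x -> e y x = (nbr x == y).
Proof. by move=> lx; rewrite sym nbrP // eq_sym. Qed.

Let deg_ge3 v : ~~ leaf v -> 2 < deg e v.
Proof. by move: (deg_neq0 v) (deg_neq2 v); rewrite /leaf; case: deg => [|[|[]]]. Qed.

Let star v := ~~ leaf v && [forall u, e v u ==> leaf u].
Let leaves v := [seq u <- enum V | e v u && leaf u].
Let r i v := nth v (leaves v) i.

Let uniq_filter_enum (P : pred V) : uniq [seq x <- enum V | P x].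
Proof. exact/filter_uniq/enum_uniq. Qed.

Let mem_leaves v u : (u \in leaves v) = e v u && leaf u.
Proof. by rewrite mem_filter mem_enum andbT. Qed.

Let uniq_leaves v : uniq (leaves v).
Proof. exact: uniq_filter_enum. Qed.

Let rP i v : i < size (leaves v) -> e v (r i v) && leaf (r i v).
Proof. by move=> lti; rewrite -mem_leaves mem_nth. Qed.

Let nbr_r i v : i < size (leaves v) -> nbr (r i v) = v.
Proof. by move=> /rP/andP[evr lr]; apply/eqP; rewrite -leaf_nbrE. Qed.

Let r_inj i j v w : i < size (leaves v) -> j < size (leaves w) ->
  r i v = r j w -> v = w /\ i = j.
Proof.
move=> iv jw E; have vw : v = w by rewrite -(nbr_r iv) E nbr_r.
move: jw E; rewrite -vw => jv /eqP; rewrite /r nth_uniq //.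
by move/eqP.
Qed.

Let size_leaves_star v : star v -> 2 < size (leaves v).
Proof.
move=> /andP[lv /forallP st]; apply: leq_trans (deg_ge3 lv) _.
rewrite /deg cardE /leaves -(size_map id) uniq_leq_size ?map_id ?enum_uniq // => u.
by rewrite mem_enum inE mem_filter mem_enum andbT => evu; rewrite evu (implyP (st u)).
Qed.

(* In a component K2 the two leaves are placed [size K1] apart: their edge is
   labelled by the first one, and the vertex weight of the second must stay
   at most s. *)
Let K1 := [seq x <- enum V | [&& leaf x, leaf (nbr x) & enum_rank x < enum_rank (nbr x)]].
Let K2 := map nbr K1.
Let Us := [seq v <- enum V | star v].
Let Un := [seq v <- enum V | [&& ~~ leaf v, ~~ star v & 0 < size (leaves v)]].
(** Star centres come first, so each has the same position in [Us] and in [U]. *)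
Let U := Us ++ Un.
Let U2 := [seq v <- U | 1 < size (leaves v)].
Let T1 := map (r 0) U.
Let T2 := map (r 1) U2.
(* Reversed, so that in a star the deficits s - label of the first and of the
   third leaf add up to at most s. *)
Let T3 := map (r 2) (rev Us).
Let others := [seq x <- enum V | leaf x && (x \notin (K1 ++ K2 ++ T1) ++ T3 ++ T2)].
Let L := (K1 ++ K2 ++ T1) ++ others ++ T3 ++ T2.

Let k := size K1.
Let M := size U.
Let n1 := #|[set v | leaf v]|.
Let N := #|[set v | ~~ leaf v]|.

Let mem_Us v : (v \in Us) = star v.
Proof. by rewrite mem_filter mem_enum andbT. Qed.

Let mem_U v : (v \in U) = ~~ leaf v && (0 < size (leaves v)).
Proof.
rewrite mem_cat mem_Us mem_filter mem_enum andbT.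
have [sv|//] := boolP (star v).
by have := size_leaves_star sv; case/andP: sv => -> _; case: size.
Qed.

Let uniq_U : uniq U.
Proof.
rewrite cat_uniq !uniq_filter_enum /= andbT.
by apply/hasPn => v; rewrite mem_Us mem_filter => /andP[/and3P[_ -> _]].
Qed.

Let mem_U2 v : v \in U2 -> 1 < size (leaves v).
Proof. by rewrite mem_filter => /andP[]. Qed.

Let mem_K1 x : (x \in K1) = [&& leaf x, leaf (nbr x) & enum_rank x < enum_rank (nbr x)].
Proof. by rewrite mem_filter mem_enum andbT. Qed.

Let nbrK x : leaf x -> leaf (nbr x) -> nbr (nbr x) = x.
Proof. by move=> lx lnx; apply/eqP; rewrite -leaf_nbrE // nbrP. Qed.

Let nbr_neq x : leaf x -> nbr x != x.
Proof. by move=> lx; apply/eqP => E; have := irr x; rewrite nbrP // E eqxx. Qed.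

Let mem_K2 x : (x \in K2) = [&& leaf x, leaf (nbr x) & enum_rank (nbr x) < enum_rank x].
Proof.
apply/mapP/and3P => [[y]|[lx lnx lt]].
  by rewrite mem_K1 => /and3P[ly lny lt] ->; rewrite nbrK.
by exists (nbr x); rewrite ?mem_K1 nbrK // lx lnx.
Qed.

Let mem_K x : (x \in K1 ++ K2) = leaf x && leaf (nbr x).
Proof.
rewrite mem_cat mem_K1 mem_K2; case lx: (leaf x) => //=; case: (leaf _) => //=.
have := nbr_neq lx.
by rewrite -(inj_eq enum_rank_inj) -(inj_eq val_inj) /= neq_ltn orbC.
Qed.

Let uniq_K : uniq (K1 ++ K2).
Proof.
rewrite cat_uniq uniq_filter_enum /=; apply/andP; split.
  apply/hasPn => x; rewrite mem_K1 mem_K2 => /and3P[_ _ lt].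
  by apply/and3P => -[_ _]; lia.
rewrite map_inj_in_uniq ?uniq_filter_enum // => x y.
rewrite !mem_K1 => /and3P[lx lnx _] /and3P[ly lny _] E.
by rewrite -(nbrK lx lnx) E nbrK.
Qed.

Let T1_r v : v \in U -> 0 < size (leaves v). Proof. by rewrite mem_U => /andP[]. Qed.
Let T3_r v : v \in rev Us -> 2 < size (leaves v).
Proof. by rewrite mem_rev mem_Us => /size_leaves_star. Qed.

Let T_nbr x : x \in T1 ++ T3 ++ T2 -> leaf x && ~~ leaf (nbr x).
Proof.
have U_leaf v : v \in U -> ~~ leaf v by rewrite mem_U => /andP[].
rewrite !mem_cat => /or3P[] /mapP[v vU ->].
- by rewrite nbr_r ?T1_r // U_leaf // andbT; have /andP[] := rP (T1_r vU).
- rewrite nbr_r ?T3_r // U_leaf ?andbT; last by rewrite mem_cat -mem_rev vU.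
  by have /andP[] := rP (T3_r vU).
rewrite nbr_r ?mem_U2 // U_leaf ?andbT; last by move: vU; rewrite mem_filter => /andP[].
by have /andP[] := rP (mem_U2 vU).
Qed.

Let uniq_T : uniq (T1 ++ T3 ++ T2).
Proof.
have disj i j (A B : seq V) : i != j -> {in A, forall v, i < size (leaves v)} ->
    {in B, forall v, j < size (leaves v)} -> ~~ has (mem (map (r i) A)) (map (r j) B).
  move=> ij Ai Bj; apply/hasPn => _ /mapP[v vB ->]; apply/mapP => -[w wA].
  by move/(r_inj (Bj v vB) (Ai w wA)) => [_ E]; rewrite E eqxx in ij.
have Uq i (A : seq V) : uniq A -> {in A, forall v, i < size (leaves v)} -> uniq (map (r i) A).
  move=> UA Ai; rewrite map_inj_in_uniq // => v w vA wA.
  by move/(r_inj (Ai v vA) (Ai w wA)) => [].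
rewrite !cat_uniq has_cat negb_or.
rewrite (Uq 0 U uniq_U T1_r) (Uq 2 (rev Us)) ?rev_uniq ?uniq_filter_enum //.
rewrite (Uq 1 U2) ?filter_uniq //.
by rewrite (disj 0 2 U (rev Us)) // (disj 0 1 U U2) // (disj 2 1 (rev Us) U2).
Qed.

Let uniq_L : uniq L.
Proof.
rewrite uniq_catCA cat_uniq uniq_filter_enum /=; apply/andP; split.
  by apply/hasPn => x xR; rewrite mem_filter xR andbF.
rewrite -!catA catA cat_uniq uniq_K uniq_T andbT /=.
by apply/hasPn => x /T_nbr /andP[lx lnx]; rewrite mem_K lx.
Qed.

Let mem_L x : (x \in L) = leaf x.
Proof.
have inR : x \in (K1 ++ K2 ++ T1) ++ T3 ++ T2 -> leaf x.
  rewrite -!catA catA mem_cat mem_K => /orP[/andP[]//|/T_nbr/andP[]//].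
rewrite (mem_cat _ (K1 ++ K2 ++ T1)) (mem_cat _ others) orbCA -mem_cat.
rewrite mem_filter mem_enum andbT; have [/inR->|_] := boolP (x \in _ ++ T3 ++ T2).
  by rewrite orbT.
by rewrite andbT orbF.
Qed.

Let size_L : size L = n1.
Proof.
by rewrite -(card_uniqP uniq_L); apply: eq_card => x; rewrite mem_L inE.
Qed.

Let size_L_blocks : n1 = 2 * k + M + size others + size Us + size T2.
Proof. by rewrite -size_L !size_cat !size_map size_rev; lia. Qed.

Let leq_size_T2 : size T2 <= M.
Proof. by rewrite size_map size_filter count_size. Qed.

Let card_internal : N + n1 = #|V|.
Proof.
rewrite /N /n1 addnC -cardsT -[RHS](cardsID [set v | leaf v]); congr (_ + _).
  by apply: eq_card => v; rewrite !inE.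
by apply: eq_card => v; rewrite !inE andbT.
Qed.

Let card_K : #|[set v | leaf v && leaf (nbr v)]| = 2 * k.
Proof.
have -> : 2 * k = size (K1 ++ K2) by rewrite size_cat size_map addnn mul2n.
rewrite -(card_uniqP uniq_K).
by apply: eq_card => v; rewrite !inE mem_K.
Qed.

(** * Two degree counts *)

(** Outside the K2 components, N internal vertices of degree at least 3 and n1 - 2k leaves of degree
    1 span a forest; its degree sum is bounded. *)
Let internal_bound : 0 < N -> N + 2 * k + 2 <= n1.
Proof.
move=> /card_gt0P[v0]; rewrite inE => lv0.
pose K := [set v | leaf v && leaf (nbr v)].
have X0 : ~: K != set0 by apply/set0Pn; exists v0; rewrite !inE negb_and lv0.
have cardX : #|~: K| = N + n1 - 2 * k.
  by rewrite card_internal -(cardsC K) card_K addKn.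
have leafX : \sum_(v in ~: K) leaf v + 2 * k = n1.
  rewrite -card_K -/K /n1 -[RHS](cardsID K) addnC; congr (_ + _).
    by apply: eq_card => v; rewrite !inE; case: (leaf v); rewrite ?andbF.
  rewrite -sum1_card big_mkcond [RHS]big_mkcond; apply: eq_bigr => v _.
  by rewrite !inE; case: (leaf v); case: (leaf _).
(* The term [2 * leaf v] lifts leaves to the bound 3 of internal vertices, so one sum treats
   both. *)
have degX v : v \in ~: K -> 3 <= #|[set u in ~: K | e v u]| + 2 * leaf v.
  rewrite !inE => vK.
  have -> : #|[set u in ~: K | e v u]| = deg e v.
    apply: eq_card => u; rewrite !inE andbC; have [evu|//] := boolP (e v u).
    rewrite andTb; apply: contra vK => /andP[lu lnu].
    have /eqP <- : nbr u == v by rewrite -leaf_nbrE.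
    by rewrite nbrK // lu lnu.
  by have := @deg_ge3 v; rewrite /leaf; case: eqP => [->|_ /(_ isT)]; lia.
have := leq_sum (index_enum V) degX; rewrite big_split /= -big_distrr /= sum_nat_const.
by have := forest_degree_sum Fe X0; lia.
Qed.

(** In the forest induced on the internal vertices that are not star centres, a vertex without
    leaves keeps degree at least 3 and one with leaves at least 1, so the former cannot outnumber
    the latter. *)
Let nonleafy_bound : N <= 2 * M.
Proof.
pose X := [set v | ~~ leaf v && ~~ star v].
have cardX : N = size Us + #|X|.
  rewrite /N -(cardsID [set v | star v]); congr (_ + _).
    rewrite -(card_uniqP (uniq_filter_enum star)); apply: eq_card => v.
    by rewrite !inE mem_filter mem_enum andbT /star; case: (leaf v).
  by apply: eq_card => v; rewrite !inE andbC.
have sizeU : M = size Us + size Un by rewrite /M size_cat.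
have [E|X0] := eqVneq X set0; first by move: cardX; rewrite E cards0; lia.
have leafyX : \sum_(v in X) (0 < size (leaves v)) = size Un.
  rewrite -(card_uniqP (uniq_filter_enum _)) -sum1_card.
  rewrite big_mkcond [RHS]big_mkcond; apply: eq_bigr => v _.
  by rewrite !inE mem_filter mem_enum andbT andbA; case: (_ && _); case: (0 < _).
have starX v u : e v u -> ~~ leaf v -> ~~ star u.
  move=> evu lv; rewrite negb_and; apply/orP; right; apply/forallPn; exists v.
  by rewrite sym evu.
have degX v : v \in X -> 3 <= #|[set u in X | e v u]| + 2 * (0 < size (leaves v)).
  rewrite inE => /andP[lv sv]; case: posnP => [/size0nil nil_v|_].
    have -> : #|[set u in X | e v u]| = deg e v; last by have := deg_ge3 lv; lia.
    apply: eq_card => u; rewrite !inE andbC; have [evu|//] := boolP (e v u).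
    rewrite (starX v) // andbT /=; apply/negP => lu.
    by have := mem_leaves v u; rewrite nil_v evu lu.
  suff : 0 < #|[set u in X | e v u]| by lia.
  move: sv; rewrite negb_and lv => /forallPn[u]; rewrite negb_imply => /andP[evu lu].
  by apply/card_gt0P; exists u; rewrite !inE lu evu (starX v).
have := leq_sum (index_enum V) degX; rewrite big_split /= -big_distrr /= sum_nat_const.
by have := forest_degree_sum Fe X0; lia.
Qed.

(** * Positions in the order *)

Let idx x := index x L.

Let idx_nbr x : x \in K1 -> idx (nbr x) = k + idx x /\ idx x < k.
Proof.
move=> xK; have lt : index x K1 < size K1 by rewrite index_mem.
have LE : L = K1 ++ K2 ++ T1 ++ others ++ T3 ++ T2 by rewrite /L !catA.
have UL := uniq_L; rewrite LE in UL.
have Ex : idx x = index x K1 by rewrite /idx LE index_cat xK.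
split; last by rewrite Ex.
rewrite Ex -(index_block (s1 := K1) x UL (i := index x K1)) ?size_map //.
by rewrite (nth_map x) // nth_index // -LE.
Qed.

Let idx_r0 v : v \in U -> idx (r 0 v) = 2 * k + index v U /\ index v U < M.
Proof.
move=> vU; have lt : index v U < size U by rewrite index_mem.
have LE : L = (K1 ++ K2) ++ T1 ++ others ++ T3 ++ T2 by rewrite /L !catA.
have UL := uniq_L; rewrite LE in UL.
have := index_block (s1 := K1 ++ K2) v UL (i := index v U).
rewrite -LE [nth _ T1 _](nth_map v) // nth_index // -/(idx _) => -> //; last by rewrite /T1 size_map.
by rewrite size_cat [size K2]size_map addnn mul2n.
Qed.

(** As [T3] is reversed, the indices of [r 0 v] and [r 2 v] have the same sum for all star
    centres. *)
Let idx_r2 v : star v -> idx (r 2 v) + index v U + size T2 + 1 = n1 /\ index v U < size Us.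
Proof.
rewrite -mem_Us => vUs; have lt : index v Us < size Us by rewrite index_mem.
have LE : L = ((K1 ++ K2 ++ T1) ++ others) ++ T3 ++ T2 by rewrite /L !catA.
have UL := uniq_L; rewrite LE in UL.
rewrite index_cat vUs; split=> //.
have := index_block (s1 := (K1 ++ K2 ++ T1) ++ others) v UL (i := size Us - (index v Us).+1).
rewrite -LE [nth _ T3 _](nth_map v) ?size_rev; last by lia.
rewrite nth_rev; last by lia.
rewrite (_ : size Us - (size Us - (index v Us).+1).+1 = index v Us); last by lia.
rewrite nth_index // -/(idx _) => ->; last by rewrite /T3 size_map size_rev; lia.
by rewrite !size_cat [size K2]size_map [size T1]size_map size_L_blocks /M -/k size_cat; set c := size others; lia.
Qed.

Let idx_r1 v : ~~ leaf v -> 1 < size (leaves v) -> n1 <= idx (r 1 v) + size T2.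
Proof.
move=> lv lt; have vT2 : r 1 v \in T2.
  by apply: map_f; rewrite mem_filter lt mem_U lv; lia.
have LE : L = ((K1 ++ K2 ++ T1) ++ others ++ T3) ++ T2 by rewrite /L -!catA.
have := uniq_L; rewrite LE cat_uniq => /and3P[_ /hasPn/(_ _ vT2) notin _].
rewrite /idx -size_L LE index_cat (negPf notin) size_cat.
by rewrite addnAC leq_addr.
Qed.

Let idx_late u v : leaf u -> ~~ leaf v -> e v u -> u != r 0 v -> 2 * k + M <= idx u.
Proof.
move=> lu lv evu neq; rewrite /idx /L index_cat ifF.
  apply: leq_trans (leq_addr _ _); rewrite !size_cat [size K2]size_map [size T1]size_map.
  by rewrite addnA addnn mul2n.
apply/negbTE; rewrite catA mem_cat mem_K lu negb_or.
have /eqP nu : nbr u == v by rewrite -leaf_nbrE.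
rewrite nu lv andTb; apply/mapP => -[w wU E].
by move: neq; rewrite -nu E nbr_r ?T1_r // eqxx.
Qed.

Let idx_leaf x : leaf x -> idx x < n1.
Proof. by rewrite -mem_L -index_mem size_L. Qed.

Let idx_internal x : ~~ leaf x -> idx x = n1.
Proof. by move=> lx; rewrite /idx memNindex ?mem_L // size_L. Qed.

(** * Edge sums and exceptional vertices *)

Variable s : nat.
Hypothesis s_n1 : n1 < 2 * s <= n1 + 2.

Let sum_ge v (l : seq V) (f : V -> nat) : uniq l -> all (e v) l ->
  2 * s <= \sum_(u <- l) f u -> 2 * s <= \sum_(u | e v u) f u.
Proof. by move=> Ul al /leq_trans; apply; apply: leq_sum_uniq. Qed.

Let s_n1' : s.-1 <= n1. Proof. move: s_n1; clear; lia. Qed.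

(** Two edges of weight s suffice. If a leaf other than [r 0 v] is small, [r 1 v] still gives s, and
    another s comes from an internal neighbour or, at a star centre, from the first and third leaves
    together. *)
Let edge_sum_ge v : ~~ leaf v -> 2 * s <= \sum_(u | e v u) (s - (s.-1 - idx u)).
Proof.
move=> lv; have [allbig|] := boolP [forall u, (e v u && (u != r 0 v)) ==> (s.-1 <= idx u)].
  (* If [v] has no leaf, [r 0 v] is [v] itself and its removal costs nothing. *)
  have : 1 < #|[set u | e v u] :\ r 0 v|.
    by have := deg_ge3 lv; rewrite /deg (cardsD1 (r 0 v)); case: (_ \in _); lia.
  case/card_gt1P => a [b []]; rewrite !inE => /andP[na ea] /andP[nb eb] ab.
  apply: (@sum_ge v [:: a; b]); rewrite /= ?ea ?eb ?inE ?ab //.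
  rewrite !big_cons big_nil addn0 mul2n -addnn.
  have /forallP/(_ a) := allbig; have /forallP/(_ b) := allbig.
  by rewrite ea eb na nb => /label_max-> /label_max->.
rewrite negb_forall => /existsP[u]; rewrite negb_imply -ltnNge -andbA => /and3P[evu nu ltu].
have lu : leaf u by apply: contraLR ltu => /idx_internal->; rewrite -leqNgt.
have late := idx_late lu lv evu nu.
have uv : u \in leaves v by rewrite mem_leaves evu.
have size2 : 1 < size (leaves v).
  rewrite ltnNge; apply/negP => size1; move: uv nu; rewrite /r.
  by case: (leaves v) size1 => [|c [|? ?]] // _; rewrite inE => /eqP-> /eqP.
(* A small [u] after [T1] forces M < s - 1; as n1 >= 2s - 2, the last M places are not small. *)
have big1 : s.-1 <= idx (r 1 v).
  move: (idx_r1 lv size2) s_n1 leq_size_T2 late ltu; clear; lia.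
have /andP[e1 l1] := rP size2.
have [sv|] := boolP (star v); last first.
  rewrite negb_and lv => /forallPn[w]; rewrite negb_imply => /andP[evw lw].
  apply: (@sum_ge v [:: r 1 v; w]); rewrite /= ?evw ?e1 // ?inE ?andbT.
    by apply: contraNneq lw => <-.
  by rewrite !big_cons big_nil (label_max big1) label_max ?addn0 ?mul2n ?addnn ?idx_internal.
have size3 := size_leaves_star sv.
have /andP[e2 l2] := rP size3.
have size1 := ltnW size2.
have /andP[e0 l0] := rP size1.
have vU : v \in U by rewrite mem_U lv.
apply: (@sum_ge v [:: r 0 v; r 1 v; r 2 v]); rewrite /= ?e0 ?e1 ?e2 //.
  by rewrite !inE !nth_uniq.
rewrite !big_cons big_nil (label_max big1).
have [E2 _] := idx_r2 sv; have [E0 _] := idx_r0 vU.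
(* If both other leaves are small, their deficits add up to 2(s - 1) - (2k + n1 - 1 - [size T2]) <=
   M + 1 < s. *)
move: s_n1 leq_size_T2 late ltu E0 E2; clear.
lia.
Qed.

(** The first leaf is small at each of the first [S] vertices of [U]; an exception there has another
    small leaf, which lies after [T1] and so in [D]. All remaining internal vertices, [Q], are
    counted as exceptions. *)
Let few_exceptions :
  #|[set v | ~~ leaf v && (#|[set u | e v u & idx u < s.-1]| != 1)]| < s.
Proof.
set B := [set v | _].
have BN : #|B| <= N by apply/subset_leq_card/subsetP => v; rewrite !inE => /andP[].
have [N0|N_gt0] := posnP N; first by move: BN s_n1; rewrite N0; clear; lia.
pose D := [set u | leaf u && (2 * k + M <= idx u < s.-1)].
have cardD : #|D| <= s.-1 - (2 * k + M).
  rewrite cardE -(size_map idx) -(size_iota (2 * k + M) (s.-1 - (2 * k + M))).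
  apply: uniq_leq_size.
    rewrite map_inj_in_uniq ?enum_uniq // => x y; rewrite !mem_enum !inE => /andP[lx _] /andP[ly _].
    by apply: (index_inj x); rewrite mem_L.
  move=> _ /mapP[x xD ->]; move: xD; rewrite mem_enum inE mem_iota => /andP[_].
  by clear; lia.
pose S := s.-1 - 2 * k.
pose Q := [set v | ~~ leaf v] :\: [set v in take S U].
have cardQ : #|Q| = N - minn S M.
  rewrite cardsD; congr (_ - _).
  rewrite (_ : _ :&: _ = [set v in take S U]).
    by rewrite cardsE (card_uniqP (take_uniq _ uniq_U)) size_take_min.
  apply/setP => v; rewrite !inE andbC; have [vS|//] := boolP (v \in take S U).
  by have := mem_take vS; rewrite mem_U => /andP[->].
have BDQ : B \subset (nbr @: D) :|: Q.
  apply/subsetP => v; rewrite !inE => /andP[lv count]; rewrite lv andbT orbC.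
  have [vS|//] := boolP (v \in take S U); rewrite orFb.
  have vU := mem_take vS; have [E0 _] := idx_r0 vU.
  have lt0 : idx (r 0 v) < s.-1.
    by move: (index_ltn vS); rewrite E0 /S; clear; lia.
  have /andP[e0 _] := rP (T1_r vU).
  have /existsP[u /and3P[evu ltu neq]] :
      [exists u, [&& e v u, idx u < s.-1 & u != r 0 v]].
    apply: contraNT count => /existsPn only; apply/cards1P; exists (r 0 v).
    apply/setP => u; rewrite !inE; have [->|neq] := eqVneq u (r 0 v); first by rewrite e0 lt0.
    by have := only u; rewrite neq andbT => /negbTE.
  have lu : leaf u.
    by apply: contraLR ltu => /idx_internal->; rewrite -leqNgt.
  apply/imsetP; exists u; last by apply/esym/eqP; rewrite -leaf_nbrE.
  by rewrite inE lu ltu (idx_late lu lv evu neq).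
have /leq_trans := subset_leq_card BDQ; move/(_ _ (leq_card_setU _ _)).
(* If [S] <= M, then [D] is empty and [internal_bound] suffices; if [S] > M, the total is at most s
   - 1 - 2k - 2M + N, and [nonleafy_bound] applies. *)
have := leq_imset_card nbr D; move: cardD (internal_bound N_gt0) nonleafy_bound s_n1.
by rewrite cardQ /S; clear; lia.
Qed.

Lemma forest_weighting : irregular_weighting_exists e s.
Proof.
apply: (weighting_of_index (idx := idx)).
- exact: proj1 Fe.
- by move=> x y lx ly; apply: (index_inj x); rewrite mem_L.
- by move=> x lx; move: (idx_leaf lx) s_n1; clear; lia.
- by move=> x /idx_internal ->.
- move=> x y lx ly exy; have ny : y = nbr x by apply/eqP; rewrite -nbrP.
  (* The K2 components use 2k of the n1 < 2s leaves. *)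
  have k_small : k <= s.-1 by move: s_n1 size_L_blocks; clear; lia.
  have : x \in K1 ++ K2 by rewrite mem_K -ny; apply/andP.
  rewrite mem_cat => /orP[xK|/mapP[z zK Ex]].
    by have [E _] := idx_nbr xK; rewrite ny E; move: k_small; clear; lia.
  have [E lt] := idx_nbr zK; rewrite -Ex in E.
  have -> : y = z by rewrite ny Ex nbrK //; move: zK; rewrite mem_K1 => /and3P[].
  by rewrite E; move: k_small; clear; lia.
- exact: edge_sum_ge.
exact: few_exceptions.
Qed.

End LeafOrder.

Theorem theorem1 (V : finType) (e : rel V) :
  0 < #|V| ->
  forest e ->
  (forall v : V, deg e v != 2) ->
  (forall v : V, deg e v != 0) ->
  tvs_is e (#|[set v : V | deg e v == 1]|.+2 %/ 2).
Proof.
move=> V_gt0 Fe d2 d0; split; last by move=> s; apply: tvs_lower_bound.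
(* The ceiling of (n1 + 1)/2 is the floor s of (n1 + 2)/2, so n1 < 2s <= n1 + 2. *)
by apply: forest_weighting => //=; lia.
Qed.
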